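(* Let $X=(X_1,\ldots,X_m)$ be a centered multivariate Gaussian with positive definite covariance matrix $\Sigma$ and $K=\Sigma^{-1}$, and suppose that there exists a CIS ordering of $X$. Then the following procedure (with arbitrary choices of the elements $k$) produces a permutation $\sigma$ of $[m]$ such that $X_\sigma=(X_{\sigma(1)},\ldots,X_{\sigma(m)})$ is CIS. (1) Initialize $O^{(1)}=[m]$, $K^{(1)}=K$, and $C^{(1)}=\{j\in[m]: K_{j,\backslash j}\le 0\}$. (2) For $i=1,\ldots,m$: take an element $k\in C^{(i)}$ and set $\sigma(m-i+1)=k$. Compute $$O^{(i+1)}=O^{(i)}\setminus\{k\},\qquad K^{(i+1)}=\big(\Sigma_{O^{(i+1)},O^{(i+1)}}\big)^{-1},\qquad C^{(i+1)}=\{j\in O^{(i+1)}: K^{(i+1)}_{j,\backslash j}\le 0\}.$$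
   Context: $[m]=\{1,\ldots,m\}$. For $O\subseteq[m]$, $\Sigma_{O,O}$ is the submatrix of $\Sigma$ with rows and columns indexed by $O$; the rows and columns of $K^{(i)}$ are indexed by the elements of $O^{(i)}$. $K^{(i)}_{j,\backslash j}\le 0$ means that all off-diagonal entries in the row of $K^{(i)}$ indexed by $j$ are non-positive (vacuously true for a $1\times 1$ matrix). After the last iteration ($i=m$) the set $O^{(m+1)}$ is empty and nothing further is computed. CIS: a random vector $Y=(Y_1,\ldots,Y_m)$ is conditionally increasing in sequence (CIS) if for every $i\in[m]$ and every fixed $y_i\in\mathbb{R}$, the function $(y_1,\ldots,y_{i-1})\mapsto \mathbb{P}(Y_i\ge y_i\mid Y_j=y_j \text{ for all } j<i)$ is non-decreasing in each coordinate (using the usual, continuous, Gaussian conditional distribution). A permutation $\sigma$ of $[m]$ is a CIS ordering of $X$ if $(X_{\sigma(1)},\ldots,X_{\sigma(m)})$ is CIS. *)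

(* Defs.v *)
From HB Require Import structures.
From mathcomp Require Import all_boot all_order all_algebra all_fingroup.
From mathcomp Require Import all_classical all_reals all_analysis.

Set Implicit Arguments.
Unset Strict Implicit.
Unset Printing Implicit Defensive.

Import Order.TTheory GRing.Theory Num.Theory.
Import numFieldNormedType.Exports.

Local Open Scope classical_set_scope.
Local Open Scope ring_scope.

(** Points of R^n are [n.-tuple R], which carries the product sigma-algebra. *)

Definition posdef (R : realType) (n : nat) (S : 'M[R]_n) : Prop :=
  S^T = S /\ forall v : 'rV[R]_n, v != 0 -> 0 < (v *m S *m v^T) 0 0.

(** Integral over R^n with respect to Lebesgue measure, as an iterated integral
    (last coordinate innermost).  It is only applied to nonnegative measurable
    functions, where Tonelli's theorem makes it the integral against the
    product measure. *)
Fixpoint lebesgue_int (R : realType) (n : nat) :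
    (n.-tuple R -> \bar R) -> \bar R :=
  match n with
  | 0 => fun f => f [tuple]
  | n'.+1 => fun f => lebesgue_int (fun y : n'.-tuple R =>
      (\int[@lebesgue_measure R]_u f [tuple of rcons y u])%E)
  end.

Definition gaussian_pdf (R : realType) (n : nat) (S : 'M[R]_n)
    (x : n.-tuple R) : R :=
  (Num.sqrt ((2 * pi) ^+ n * \det S))^-1 *
  expR (- (2^-1 * \sum_(i < n) \sum_(j < n)
                    tnth x i * invmx S i j * tnth x j)).

(** The law of [(X i)_i] is N(0, S), for positive definite S. *)
Definition centered_gaussian (d : measure_display) (T : measurableType d)
    (R : realType) (P : probability T R) (n : nat)
    (X : 'I_n -> {RV P >-> R}) (S : 'M[R]_n) : Prop :=
  forall A : set (n.-tuple R), measurable A ->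
    P [set w | A [tuple X i w | i < n]] =
    lebesgue_int (fun x => (gaussian_pdf S x * \1_A x)%:E).

(** [g] is a continuous version of [v |-> P(U >= t | V = v)].  The law
    N(0, S) with S positive definite charges every nonempty open set, so for
    subvectors of such a vector there is at most one such [g], namely the tail
    at [t] of the usual Gaussian conditional distribution.  Continuity is
    expressed through 'rV[R]_n because tuples carry no topology. *)
Definition continuous_cond_tail (d : measure_display) (T : measurableType d)
    (R : realType) (P : probability T R) (n : nat)
    (U : T -> R) (V : T -> n.-tuple R) (t : R) (g : n.-tuple R -> R) : Prop :=
  continuous (fun y : 'rV[R]_n => g [tuple y ord0 j | j < n]) /\
  forall B : set (n.-tuple R), measurable B ->
    P ([set w | t <= U w] `&` V @^-1` B) =
    (\int[P]_(w in V @^-1` B) (g (V w))%:E)%E.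

Definition nondecreasing_coordinatewise (R : realType) (n : nat)
    (g : n.-tuple R -> R) : Prop :=
  forall (k : 'I_n) (y z : n.-tuple R),
    (forall j, j != k -> tnth y j = tnth z j) ->
    tnth y k <= tnth z k -> g y <= g z.

Definition predecessors (T : Type) (R : realType) (m : nat)
    (Y : 'I_m -> T -> R) (i : 'I_m) (w : T) : i.-tuple R :=
  [tuple Y (widen_ord (ltnW (ltn_ord i)) j) w | j < i].

Definition CIS (d : measure_display) (T : measurableType d) (R : realType)
    (P : probability T R) (m : nat) (Y : 'I_m -> {RV P >-> R}) : Prop :=
  forall (i : 'I_m) (t : R), exists g : i.-tuple R -> R,
    continuous_cond_tail P (Y i) (predecessors (fun j => Y j : T -> R) i) t g /\
    nondecreasing_coordinatewise g.

Definition permuted (d : measure_display) (T : measurableType d)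
    (R : realType) (P : probability T R) (m : nat)
    (X : 'I_m -> {RV P >-> R}) (s : 'S_m) : 'I_m -> {RV P >-> R} :=
  fun i => X (s i).

Definition offdiag_nonpos (R : realType) (n : nat) (A : 'M[R]_n) (a : 'I_n) :
    bool :=
  [forall b, (b != a) ==> (A a b <= 0)].

(** Rows and columns are indexed by ranks in the enumeration of [O]. *)
Definition precision (R : realType) (m : nat) (S : 'M[R]_m) (O : {set 'I_m}) :
    'M[R]_#|O| :=
  invmx (mxsub enum_val enum_val S).

Definition candidates (R : realType) (m : nat) (S : 'M[R]_m)
    (O : {set 'I_m}) : {set 'I_m} :=
  [set enum_val a | a : 'I_#|O| & offdiag_nonpos (precision S O) a].

(** [run S ks O C]: some execution has successively taken the elements of [ks],
    and the current index set and candidate set are [O] and [C]. *)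
Inductive run (R : realType) (m : nat) (S : 'M[R]_m) :
    seq 'I_m -> {set 'I_m} -> {set 'I_m} -> Prop :=
| run_init :
    run S [::] [set: 'I_m]%SET [set j | offdiag_nonpos (invmx S) j]%SET
| run_step ks O C k :
    run S ks O C -> k \in C ->
    run S (rcons ks k) (O :\ k)%SET (candidates S (O :\ k)%SET).

(* Main.v *)
Require Import Defs.
From HB Require Import structures.
From mathcomp Require Import all_boot all_order all_algebra all_fingroup.
From mathcomp Require Import all_classical all_reals all_analysis.
From mathcomp Require Import measurable_realfun normal_distribution.
From mathcomp Require Import ring lra.
Import Order.TTheory GRing.Theory Num.Theory.
Import numFieldNormedType.Exports.
Local Open Scope ring_scope.

Set Implicit Arguments.
Unset Strict Implicit.
Unset Printing Implicit Defensive.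

(** The proof separates a statement about precision matrices from a statement
    about conditional distributions.

    Write [K] for the precision matrix of the coordinates in [O], and call [k]
    a candidate of [O] when the off-diagonal entries of row [k] of [K] are
    nonpositive.  An ordering is CIS if and only if every element is a
    candidate of the set formed by itself and its predecessors
    ([CIS_sign_ordering]).  Indeed, conditionally on its predecessors the last
    coordinate is normal, its variance is constant and its mean is linear with
    coefficients [- K n j / K n n]; the conditional tail is a strictly
    increasing function of this mean.  To obtain this from the joint density,
    complete the square in the last coordinate: this factors the density into
    a Gaussian density whose matrix is the Schur complement, which is again
    the precision matrix of the remaining coordinates, and a normal density
    ([gauss_weight_rcons], [cond_tail_identity], [gaussian_law_prefix]).
    Nonnegative coefficients thus make the normal tail a monotone continuous
    version.  Conversely, a monotone version has the same averages as the
    normal tail; comparing averages over two small boxes, one above the other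
    in the coordinatewise order, shows that no coefficient can be negative
    ([monotone_version_coef_ge0]).

    The statement about matrices rests on the Schur complement formula
    [K' k b = K k b - K k l * K l b / K l l] for the deletion of [l].  If [k]
    and [l] are both candidates, the correction is a product of two
    nonpositive numbers, so entries of row [k] only decrease and [k] remains a
    candidate ([cand_drop]).  Suppose now that some ordering works.  Deleting
    the last elements one after the other, each of them a candidate when it is
    deleted, shows that a candidate [k] of the full set is also a candidate of
    every initial segment that contains it ([cand_upto]).  By [cand_drop]
    again, each element after [k] is still a candidate of its initial segment
    once [k] is removed: the same ordering, with [k] erased, works for the
    remaining set, whichever candidate [k] was chosen ([eliminable_drop]).  So
    the procedure always finds a candidate, for instance the last remaining
    element of that ordering, and the elements it takes, read backwards, are
    by construction candidates of their initial segments. *)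

(** * Precision matrices of subvectors *)

Section PositiveDefinite.
Variables (R : realType) (n : nat).
Implicit Type S : 'M[R]_n.

Lemma posdef_unit S : posdef S -> S \in unitmx.
Proof.
move=> [_ Spos]; rewrite -row_free_unit; apply: inj_row_free => v vS0.
by apply/eqP/negP => /negP /Spos; rewrite vS0 mul0mx mxE ltxx.
Qed.

Lemma posdef_invmx S : posdef S -> posdef (invmx S).
Proof.
move=> Spd; have Su := posdef_unit Spd; case: (Spd) => Ssym Spos.
have Visym : (invmx S)^T = invmx S by rewrite trmx_inv Ssym.
split=> // v v0.
have := Spos (v *m invmx S).
rewrite mulmxKV// trmx_mul Visym mulmxA; apply.
by apply: contra v0 => /eqP vS0; rewrite -[v](mulmxKV Su) vS0 mul0mx.
Qed.

Lemma posdef_diag_gt0 S (k : 'I_n) : posdef S -> 0 < S k k.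
Proof.
move=> [_ /(_ (delta_mx 0 k))]; rewrite -rowE trmx_delta -colE !mxE; apply.
by apply/eqP => /matrixP /(_ 0 k) /eqP; rewrite !mxE !eqxx oner_eq0.
Qed.

Lemma posdef_sym S (a b : 'I_n) : posdef S -> S a b = S b a.
Proof. by case=> /matrixP /(_ b a); rewrite mxE. Qed.

End PositiveDefinite.

Section Precision.
Variables (R : realType) (m : nat) (S : 'M[R]_m).
Hypothesis Spd : posdef S.
Implicit Types (O : {set 'I_m}) (a b c k l : 'I_m).

(** Keeping the size [m] and padding with the identity makes the inverses for
    different index sets matrices of the same type, so that they can be compared
    entry by entry without casts. *)
Definition pad O : 'M[R]_m :=
  \matrix_(a, b) if (a \in O) && (b \in O) then S a b else (a == b)%:R.

Definition prec O : 'M[R]_m := invmx (pad O).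

Lemma pad_in_out O a b : b \notin O -> pad O a b = (a == b)%:R.
Proof. by move=> /negbTE bO; rewrite mxE bO andbF. Qed.

Lemma pad_out_in O a b : a \notin O -> pad O a b = (a == b)%:R.
Proof. by move=> /negbTE aO; rewrite mxE aO. Qed.

Lemma padT : pad [set: 'I_m] = S.
Proof. by apply/matrixP => a b; rewrite mxE !inE. Qed.

(** The quadratic form of [pad O] is that of [S] on the coordinates in [O] plus
    the sum of the squares of the other coordinates. *)
Lemma posdef_pad O : posdef (pad O).
Proof.
case: (Spd) => Ssym Spos; split.
  apply/matrixP => a b; rewrite !mxE andbC (eq_sym a b).
  by rewrite (posdef_sym b a Spd).
move=> v v0.
pose v1 : 'rV[R]_m := \row_a if a \in O then v 0 a else 0.
have quadE : (v *m pad O *m v^T) 0 0 =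
    (v1 *m S *m v1^T) 0 0 + \sum_(a | a \notin O) v 0 a ^+ 2.
  rewrite !mxE [LHS](bigID (mem O)) /= [X in _ = X + _](bigID (mem O)) /=.
  rewrite -addrA; congr +%R.
    apply: eq_bigr => b bO; rewrite !mxE bO; congr (_ * _).
    rewrite [LHS](bigID (mem O)) /= [RHS](bigID (mem O)) /=; congr +%R.
      by apply: eq_bigr => a aO; rewrite !mxE bO aO.
    rewrite !big1// => a aO; first by rewrite !mxE (negbTE aO) mul0r.
    rewrite pad_out_in// (_ : a == b = false) ?mulr0//.
    by apply: contraNF aO => /eqP->.
  rewrite [X in _ = X + _]big1 ?add0r; last first.
    by move=> a aO; rewrite !mxE (negbTE aO) mulr0.
  apply: eq_bigr => b bO; rewrite !mxE (bigD1 b)//= pad_in_out// eqxx mulr1.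
  rewrite big1 ?addr0 ?expr2// => a /negbTE ab.
  by rewrite pad_in_out// ab mulr0.
rewrite quadE; have [v10|/Spos v1pos] := eqVneq v1 0; last first.
  by rewrite ltr_wpDr// sumr_ge0// => a _; rewrite sqr_ge0.
rewrite v10 mul0mx mul0mx mxE add0r.
have [a va] : exists a, v 0 a != 0.
  apply/existsP; apply: contraNT v0; rewrite negb_exists => /forallP v0.
  by apply/eqP/rowP => a; rewrite mxE; apply/eqP; rewrite -[_ == _]negbK.
have aO : a \notin O.
  apply: contra va => aO; move/rowP: v10 => /(_ a) /eqP.
  by rewrite !mxE aO.
rewrite (bigD1 a)//= ltr_pwDl// ?exprn_even_gt0//.
by rewrite sumr_ge0// => b _; rewrite sqr_ge0.
Qed.

Lemma prec_sym O a b : prec O a b = prec O b a.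
Proof. exact/posdef_sym/posdef_invmx/posdef_pad. Qed.

Lemma prec_gt0 O k : 0 < prec O k k.
Proof. exact/posdef_diag_gt0/posdef_invmx/posdef_pad. Qed.

Lemma mul_pad_prec O : pad O *m prec O = 1%:M.
Proof. exact/mulmxV/posdef_unit/posdef_pad. Qed.

(** The Schur complement formula: marginalising out [k].  The right-hand side,
    as a vector indexed by [a], vanishes at [k], so outside row [k] the matrix
    [pad (O :\ k)] acts on it as [pad O] does; the two terms become multiples of
    the basis vectors [c] and [k], and the latter is zero outside row [k]. *)
Lemma prec_drop O k a c : k \in O -> a != k -> c != k ->
  prec (O :\ k) a c = prec O a c - prec O a k * prec O k c / prec O k k.
Proof.
move=> kO ak ck; have kk0 : prec O k k != 0 by rewrite gt_eqF// prec_gt0.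
pose w := \col_b (prec O b c - prec O b k * prec O k c / prec O k k).
have wk : w k 0 = 0 by rewrite mxE mulrAC divff// mul1r subrr.
suff padw : pad (O :\ k) *m w = delta_mx c 0.
  have : invmx (pad (O :\ k)) *m (pad (O :\ k) *m w) = w.
    exact/mulKmx/posdef_unit/posdef_pad.
  by rewrite padw -colE => /colP /(_ a); rewrite !mxE.
apply/colP => b; rewrite [RHS]mxE eqxx andbT.
have [->|bk] := eqVneq b k.
  rewrite mxE (bigD1 k)//= wk mulr0 add0r big1 => [|a' /negbTE a'k].
    by rewrite eq_sym (negbTE ck).
  by rewrite pad_out_in ?in_setD1 ?eqxx// eq_sym a'k mul0r.
transitivity ((pad O *m w) b 0).
  rewrite !mxE (bigD1 k)//= wk mulr0 add0r [RHS](bigD1 k)//= wk mulr0 add0r.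
  by apply: eq_bigr => a' a'k; rewrite !mxE !in_setD1 bk a'k.
rewrite mxE; under eq_bigr do rewrite [w _ _]mxE mulrBr !mulrA.
rewrite sumrB -!mulr_suml.
have /matrixP P1 := mul_pad_prec O.
have := P1 b c; have := P1 b k; rewrite !mxE => -> ->.
by rewrite (negbTE bk) !mul0r subr0.
Qed.

(** Inverting [pad O] inverts its block on [O], whatever injective enumeration
    [f] of [O] is used to write that block as a matrix. *)
Lemma invmx_mxsub n (f : 'I_n -> 'I_m) : injective f ->
  invmx (mxsub f f S) = mxsub f f (prec [set f i | i : 'I_n]).
Proof.
move=> finj; set O := [set f i | i : 'I_n].
have fO i : f i \in O by apply: imset_f.
have SV : mxsub f f S *m mxsub f f (prec O) = 1%:M.
  apply/matrixP => i l; rewrite !mxE.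
  have /matrixP /(_ (f i) (f l)) := mul_pad_prec O.
  rewrite !mxE (inj_eq finj) => <-.
  rewrite [RHS](bigID (mem O)) /= [X in _ = _ + X]big1 ?addr0; last first.
    move=> b bO; rewrite pad_in_out//; case: eqP => [fib|]; last by rewrite mul0r.
    by move: bO; rewrite -fib fO.
  rewrite big_imset/=; last by move=> ? ? _ _; exact: finj.
  by apply: eq_bigr => j _; rewrite !mxE !fO.
have [Su _] := mulmx1_unit SV.
by rewrite -[RHS](mulKmx Su) SV mulmx1.
Qed.

(** * Elimination of candidates *)

(** The set [candidates S O] of the procedure, described inside ['I_m] rather
    than through the enumeration of [O]; see [candidatesE]. *)
Definition cand O : {set 'I_m} :=
  [set k in O | [forall b in O, (b != k) ==> (prec O k b <= 0)]].

Lemma candP O k :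
  reflect (k \in O /\ forall b, b \in O -> b != k -> prec O k b <= 0)
          (k \in cand O).
Proof.
rewrite inE; apply: (iffP andP) => -[kO kle]; split=> //.
  by move=> b bO bk; move/forall_inP: kle => /(_ b bO) /implyP; apply.
by apply/forall_inP => b bO; apply/implyP => bk; exact: kle.
Qed.

Lemma enum_val_imset O : [set enum_val i | i : 'I_#|O|] = O.
Proof.
apply/setP => x; apply/imsetP/idP => [[i _ ->]|xO]; first exact: enum_valP.
by exists (enum_rank_in xO x); rewrite ?enum_rankK_in.
Qed.

Lemma candidatesE O : candidates S O = cand O.
Proof.
have precE : precision S O = mxsub enum_val enum_val (prec O).
  by rewrite /precision invmx_mxsub ?enum_val_imset//; exact: enum_val_inj.
apply/setP => k; apply/imsetP/candP => [[a]|[kO kle]].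
  rewrite inE /offdiag_nonpos precE => /forallP ale ->.
  split=> [|b bO bk]; first exact: enum_valP.
  have /implyP := ale (enum_rank_in bO b); rewrite !mxE enum_rankK_in//; apply.
  by apply: contraNneq bk => <-; rewrite enum_rankK_in.
exists (enum_rank_in kO k); last by rewrite enum_rankK_in.
rewrite inE /offdiag_nonpos precE; apply/forallP => b; apply/implyP => bk.
rewrite mxE enum_rankK_in//; apply: kle; first exact: enum_valP.
by apply: contraNneq bk => bk; apply/eqP/enum_val_inj; rewrite enum_rankK_in.
Qed.

(** In the formula of [prec_drop] the correction is the product of an entry of
    row [k] and an entry of row [l], both nonpositive, divided by a positive
    number; the entries of row [k] can only decrease. *)
Lemma cand_drop O k l : k \in cand O -> l \in cand O -> k != l ->
  k \in cand (O :\ l).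
Proof.
move=> /candP[kO kle] /candP[lO lle] kl; apply/candP; split.
  by rewrite in_setD1 kl.
move=> b; rewrite in_setD1 => /andP[bl bO] bk.
rewrite prec_drop// (le_trans _ (kle b bO bk))// gerBl.
apply: divr_ge0; last exact/ltW/prec_gt0.
by apply: mulr_le0; [apply: kle; rewrite // eq_sym|exact: lle].
Qed.

Section Ordering.
Variable r : 'I_m -> nat.
Hypothesis rinj : injective r.

(** The order under study is the one in which [r] increases; [r] will be the
    inverse of a permutation. *)
Definition upto O j : {set 'I_m} := [set x in O | (r x <= r j)%N].

(** The elements of [O] can be removed from the last to the first, each being a
    candidate at the time of its removal. *)
Definition eliminable O := forall j, j \in O -> j \in cand (upto O j).

Lemma eliminable_last O l : eliminable O -> l \in O ->
  (forall x, x \in O -> (r x <= r l)%N) -> l \in cand O.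
Proof.
move=> gO lO lmax; have := gO l lO; congr (_ \in cand _).
by apply/setP => x; rewrite inE; case: (boolP (x \in O)) => // /lmax ->.
Qed.

Lemma exists_last O : O != finset.set0 ->
  exists2 l, l \in O & forall x, x \in O -> (r x <= r l)%N.
Proof.
by case/set0Pn => x xO; case: (arg_maxnP r xO) => l lO lmax; exists l.
Qed.

Lemma eliminable_cand O : eliminable O -> O != finset.set0 ->
  exists k, k \in cand O.
Proof. by move=> gO /exists_last[l lO lmax]; exists l; exact: eliminable_last. Qed.

Lemma upto_drop O j l : (r j < r l)%N -> upto (O :\ l) j = upto O j.
Proof.
move=> jl; apply/setP => x; rewrite !inE.
by case: eqVneq => //= ->; rewrite leqNgt jl andbF.
Qed.

(** The elements of [O] beyond [j] are removed from the last one on; each is a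
    candidate of what is left, so [cand_drop] applies to [k] every time. *)
Lemma cand_upto O k j : eliminable O -> k \in cand O -> j \in O ->
  (r k <= r j)%N -> k \in cand (upto O j).
Proof.
elim: {O}#|O| {-2}O (erefl #|O|) => [|n IH] O On gO kO jO kj.
  by move/eqP: On jO; rewrite cards_eq0 => /eqP->; rewrite inE.
have [l lO lmax] : exists2 l, l \in O & forall x, x \in O -> (r x <= r l)%N.
  by apply: exists_last; apply/set0Pn; exists j.
have [jl|jl] := eqVneq j l.
  move: kO; congr (_ \in cand _).
  by apply/setP => x; rewrite inE jl; case: (boolP (x \in O)) => // /lmax ->.
have {}jl : (r j < r l)%N.
  by rewrite ltn_neqAle lmax// (inj_eq rinj) jl.
have kl : k != l by apply: contraTneq jl => <-; rewrite -leqNgt.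
rewrite -(upto_drop O jl); apply: IH => //.
- by move: On; rewrite (cardsD1 l) lO => -[].
- move=> x; rewrite in_setD1 => /andP[xl xO]; rewrite upto_drop; first exact: gO.
  by rewrite ltn_neqAle lmax// (inj_eq rinj) xl.
- exact: cand_drop (eliminable_last gO lO lmax) kl.
- by rewrite in_setD1 jO andbT; apply: contraTneq jl => ->; rewrite ltnn.
Qed.

(** Only the elements [j] after [k] are affected.  Both [j] and [k] are candidates
    of the initial segment of [O] that ends at [j], hence [j] survives the
    deletion of [k]. *)
Lemma eliminable_drop O k : eliminable O -> k \in cand O -> eliminable (O :\ k).
Proof.
move=> gO kc j; rewrite in_setD1 => /andP[jk jO].
have [jltk|klej] := ltnP (r j) (r k); first by rewrite upto_drop//; exact: gO.
have -> : upto (O :\ k) j = upto O j :\ k by apply/setP => x; rewrite !inE andbA.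
by apply: cand_drop => //; [exact: gO|exact: cand_upto].
Qed.

End Ordering.

Definition remaining (ks : seq 'I_m) : {set 'I_m} := [set x | x \notin ks].

Lemma remaining_rcons ks k : remaining (rcons ks k) = remaining ks :\ k.
Proof. by apply/setP => x; rewrite !inE mem_rcons inE negb_or. Qed.

(** The state of an execution is a function of the elements taken so far, and
    each of them was a candidate of the set that remained when it was taken. *)
Lemma runP ks O C : run S ks O C ->
  [/\ O = remaining ks, C = cand O, uniq ks &
      forall i k, (i < size ks)%N -> nth k ks i \in cand (remaining (take i ks))].
Proof.
elim=> {ks O C} [|ks O C k _ [-> -> ksu kscand] kO].
  have -> : remaining [::] = [set: 'I_m] by apply/setP => x; rewrite !inE.
  split=> //; apply/setP => k; rewrite inE; apply/forallP/candP.
    move=> kle; split=> [|b _ bk]; first by rewrite inE.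
    have /implyP := kle b.
    by rewrite /prec padT; apply.
  by move=> [_ kle] b; apply/implyP => bk; rewrite -padT; apply: kle; rewrite ?inE.
split=> [||| i k'].
- by rewrite remaining_rcons.
- by rewrite candidatesE.
- by rewrite rcons_uniq ksu andbT; case/candP: kO; rewrite inE.
rewrite size_rcons ltnS leq_eqVlt nth_rcons -cats1 take_cat => /predU1P[->|ik].
  by rewrite ltnn eqxx subnn take0 cats0.
by rewrite ik kscand.
Qed.

Lemma run_eliminable r ks O C : injective r -> eliminable r [set: 'I_m] ->
  run S ks O C -> eliminable r O.
Proof.
move=> rinj gT; elim=> // {}ks {}O {}C k runO gO kC.
by apply: eliminable_drop => //; case: (runP runO) kC => _ ->.
Qed.

Definition prefix_set (s : 'S_m) (i : 'I_m) : {set 'I_m} :=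
  [set s j | j : 'I_m & (j <= i)%N].

(** What CIS means for the covariance matrix of a Gaussian vector, by
    [CIS_sign_ordering]. *)
Definition sign_ordering (s : 'S_m) := forall i, s i \in cand (prefix_set s i).

Lemma prefix_setE s i : prefix_set s i =
  upto (fun x => (s^-1)%g x : nat) [set: 'I_m] (s i).
Proof.
apply/setP => x; rewrite !inE permK; apply/imsetP/idP => [[j + ->]|xi].
  by rewrite inE permK.
by exists ((s^-1)%g x); rewrite ?inE ?permKV.
Qed.

Lemma sign_ordering_eliminable s : sign_ordering s ->
  eliminable (fun x => (s^-1)%g x : nat) [set: 'I_m].
Proof.
by move=> so j _; have := so ((s^-1)%g j); rewrite prefix_setE permKV.
Qed.

(** The procedure is correct for the sign condition on precision matrices; no
    probability is involved. *)
Theorem greedy_elimination :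
  (exists s, sign_ordering s) ->
  (forall (ks : seq 'I_m) (O C : {set 'I_m}),
      run S ks O C -> (size ks < m)%N -> exists k : 'I_m, k \in C) /\
  (forall (ks : m.-tuple 'I_m) (O C : {set 'I_m}),
      run S ks O C ->
      exists sigma : 'S_m,
        (forall i : 'I_m, sigma (rev_ord i) = tnth ks i) /\
        sign_ordering sigma).
Proof.
move=> [s so]; split=> [ks O C runO ksm|ks O C runO].
  have [OE -> ksu _] := runP runO.
  have sinj : injective (fun x => (s^-1)%g x : nat).
    by move=> x y /val_inj /perm_inj.
  apply: (eliminable_cand (run_eliminable sinj (sign_ordering_eliminable so) runO)).
  rewrite OE -card_gt0 -(ltn_add2l #|[set x in ks]|) addn0 cardsE.
  have -> : remaining ks = (~: [set x in ks])%SET by apply/setP => x; rewrite !inE.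
  have /card_uniqP -> := ksu.
  have := cardsC [set x in ks]; rewrite cardsE; have /card_uniqP -> := ksu.
  by rewrite card_ord => ->.
have [_ _ ksu kscand] := runP runO.
have sinj : injective (fun i : 'I_m => tnth ks (rev_ord i)).
  by move=> i j /(tuple_uniqP _ ksu)/rev_ord_inj.
exists (perm sinj); split=> [i|i]; first by rewrite permE rev_ordK.
rewrite permE (tnth_nth (s i)).
have sE j : (perm sinj j \in take (rev_ord i) ks) = (i < j)%N.
  rewrite permE in_take ?mem_tnth// (tnth_nth (s i)) index_uniq ?size_tuple//=.
    by rewrite ltn_sub2lE ?ltnS// ltn_ord.
  by rewrite ltn_subrL (leq_trans _ (ltn_ord i)).
have -> : prefix_set (perm sinj) i = remaining (take (rev_ord i) ks).
  apply/setP => x; rewrite -[x](permKV (perm sinj)) inE sE -leqNgt.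
  by rewrite mem_imset ?inE//; exact: perm_inj.
by apply: kscand; rewrite size_tuple.
Qed.

End Precision.

Local Open Scope classical_set_scope.

(** * Iterated Lebesgue integrals *)

Section Tuples.

(** The index of an [n.+1]-tuple is either [ord_max] or [lift ord_max j] for an
    index [j] of its first [n] entries; this decomposition matches the last
    coordinate that an iterated integral splits off. *)
Lemma tnth_rcons_lift (T : Type) n (y : n.-tuple T) u (j : 'I_n) :
  tnth [tuple of rcons y u] (lift ord_max j) = tnth y j.
Proof.
by rewrite !(tnth_nth u) lift_max/= nth_rcons size_tuple ltn_ord.
Qed.

Lemma tnth_rcons_max (T : Type) n (y : n.-tuple T) u :
  tnth [tuple of rcons y u] ord_max = u.
Proof. by rewrite (tnth_nth u)/= nth_rcons size_tuple ltnn eqxx. Qed.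

Lemma eq_rcons_tuple (T : Type) n (x : n.+1.-tuple T) (y : n.-tuple T) u :
  (forall j, tnth x (lift ord_max j) = tnth y j) -> tnth x ord_max = u ->
  x = [tuple of rcons y u].
Proof.
move=> xy xu; apply: eq_from_tnth => i.
by case: (unliftP ord_max i) => [j|] ->; rewrite ?tnth_rcons_lift ?tnth_rcons_max.
Qed.

Lemma measurable_rcons d (T : measurableType d) (R : realType) n
    (f : T -> n.-tuple R) (g : T -> R) :
  measurable_fun setT f -> measurable_fun setT g ->
  measurable_fun setT (fun x => [tuple of rcons (f x) (g x)]).
Proof.
move=> mf mg; apply/measurable_fun_tnthP => i.
case: (unliftP ord_max i) => [j|] ->.
  rewrite [X in measurable_fun _ X](_ : _ = (@tnth n R)^~ j \o f).
    by apply: measurableT_comp => //; exact: measurable_tnth.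
  by apply/funext => x /=; rewrite tnth_rcons_lift.
rewrite [X in measurable_fun _ X](_ : _ = g)//.
by apply/funext => x /=; rewrite tnth_rcons_max.
Qed.

End Tuples.

Section IteratedIntegral.
Variable R : realType.
Local Open Scope ereal_scope.
Local Notation leb := (@lebesgue_measure R).

Lemma measurable_last_integral_param d (S : measurableType d) n
    (f : S * n.+1.-tuple R -> \bar R) :
  measurable_fun setT f -> (forall z, 0 <= f z) ->
  measurable_fun setT (fun z : S * n.-tuple R =>
    \int[leb]_u f (z.1, [tuple of rcons z.2 u])).
Proof.
move=> mf f0.
apply: (@measurable_fun_fubini_tonelli_F _ _ _ _ _ leb
  (fun p : (S * n.-tuple R) * R => f (p.1.1, [tuple of rcons p.1.2 p.2]))) => //.
apply: (measurableT_comp mf); apply: measurable_fun_pair => /=.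
  exact: (measurableT_comp measurable_fst measurable_fst).
apply: measurable_rcons => //.
exact: (measurableT_comp measurable_snd measurable_fst).
Qed.

Lemma eq_lebesgue_int n (f g : n.-tuple R -> \bar R) :
  f =1 g -> lebesgue_int f = lebesgue_int g.
Proof. by move=> /funext->. Qed.

(** An outer integration moves inside one variable at a time by Tonelli. *)
Lemma lebesgue_int_fubini d (S : measurableType d)
    (mu : {sigma_finite_measure set S -> \bar R}) n
    (f : S * n.-tuple R -> \bar R) :
  measurable_fun setT f -> (forall z, 0 <= f z) ->
  \int[mu]_s lebesgue_int (fun x => f (s, x)) =
  lebesgue_int (fun x => \int[mu]_s f (s, x)).
Proof.
elim: n f => [//|n IH] f mf f0 /=.
rewrite (IH (fun z => \int[leb]_u f (z.1, [tuple of rcons z.2 u]))); first last.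
- by move=> z; exact: integral_ge0.
- exact: measurable_last_integral_param.
apply: eq_lebesgue_int => y.
apply: (@fubini_tonelli _ _ _ _ _ mu leb
  (fun p => f (p.1, [tuple of rcons y p.2]))) => //.
apply: (measurableT_comp mf); apply: measurable_fun_pair => //=.
exact: measurable_rcons.
Qed.

Lemma measurable_last_integral n (f : n.+1.-tuple R -> \bar R) :
  measurable_fun setT f -> (forall z, 0 <= f z) ->
  measurable_fun setT (fun y : n.-tuple R => \int[leb]_u f [tuple of rcons y u]).
Proof.
move=> mf f0.
apply: (@measurable_fun_fubini_tonelli_F _ _ _ _ _ leb
  (fun p : n.-tuple R * R => f [tuple of rcons p.1 p.2])) => //.
by apply: (measurableT_comp mf); apply: measurable_rcons.
Qed.

Definition perm_tuple n (s : 'S_n) (x : n.-tuple R) := [tuple tnth x (s i) | i < n].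

Lemma measurable_perm_tuple n (s : 'S_n) : measurable_fun setT (perm_tuple s).
Proof.
apply/measurable_fun_tnthP => i.
rewrite [X in measurable_fun _ X](_ : _ = (@tnth n R)^~ (s i)).
  exact: measurable_tnth.
by apply/funext => x /=; rewrite tnth_mktuple.
Qed.

Definition perm_invariant n (s : 'S_n) := forall f : n.-tuple R -> \bar R,
  measurable_fun setT f -> (forall x, 0 <= f x) ->
  lebesgue_int (f \o perm_tuple s) = lebesgue_int f.

Lemma perm_invariantM n (s t : 'S_n) :
  perm_invariant s -> perm_invariant t -> perm_invariant (s * t)%g.
Proof.
move=> sP tP f mf f0.
have -> : f \o perm_tuple (s * t)%g = (f \o perm_tuple s) \o perm_tuple t.
  apply/funext => x /=; congr f; apply: eq_from_tnth => i.
  by rewrite !tnth_mktuple permM.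
rewrite tP ?sP// => [|x]; last exact: f0.
by apply: measurableT_comp => //; exact: measurable_perm_tuple.
Qed.

(** A permutation that fixes the last index leaves the innermost integral alone,
    so it is handled by the outer iterated integral. *)
Lemma perm_invariant_lift n (s : 'S_n) :
  perm_invariant s -> perm_invariant (lift_perm ord_max ord_max s).
Proof.
move=> sP f mf f0 /=.
rewrite -[RHS]sP; first last.
- by move=> y; exact: integral_ge0.
- exact: measurable_last_integral.
apply: eq_lebesgue_int => y /=; apply: eq_integral => u _; congr f.
apply: eq_rcons_tuple => [j|]; rewrite tnth_mktuple.
  by rewrite lift_perm_lift tnth_rcons_lift tnth_mktuple.
by rewrite lift_perm_id tnth_rcons_max.
Qed.

Lemma perm_invariant_swap n :
  perm_invariant (tperm (lift ord_max ord_max) ord_max : 'S_n.+2).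
Proof.
move=> f mf f0 /=; apply: eq_lebesgue_int => y.
transitivity (\int[leb]_u \int[leb]_v f [tuple of rcons [tuple of rcons y v] u]);
    last first.
  apply/esym/(@fubini_tonelli _ _ _ _ _ leb leb
    (fun p => f [tuple of rcons [tuple of rcons y p.1] p.2])) => //.
  by apply: (measurableT_comp mf); do 2 apply: measurable_rcons => //.
apply: eq_integral => v _; apply: eq_integral => u _; congr f.
apply: eq_rcons_tuple => [j|]; rewrite tnth_mktuple; last first.
  by rewrite tpermR tnth_rcons_lift tnth_rcons_max.
case: (unliftP ord_max j) => [k|] ->; last first.
  by rewrite tpermL !tnth_rcons_max.
rewrite tpermD ?neq_lift// ?tnth_rcons_lift//.
by rewrite (inj_eq lift_inj) neq_lift.
Qed.

Lemma tperm_lift_perm n (a : 'I_n.+1) (i j : 'I_n) :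
  tperm (lift a i) (lift a j) = lift_perm a a (tperm i j).
Proof.
apply/permP => x; case: (unliftP a x) => [k|] ->.
  rewrite lift_perm_lift; case: (tpermP i j k) => [->|->|/eqP ki /eqP kj].
  - by rewrite tpermL.
  - by rewrite tpermR.
  - by rewrite tpermD// (inj_eq lift_inj) eq_sym.
by rewrite lift_perm_id tpermD// eq_sym neq_lift.
Qed.

(** Transpositions generate the symmetric group.  Those that fix the last index
    come from the smaller dimension, and the others are conjugate, by one of
    these, to the exchange of the last two indices. *)
Lemma lebesgue_int_perm n (s : 'S_n) : perm_invariant s.
Proof.
have inv1 k : perm_invariant (1 : 'S_k)%g.
  move=> f _ _; apply: eq_lebesgue_int => x /=; congr f.
  by apply: eq_from_tnth => i; rewrite tnth_mktuple perm1.
suff tP k (i j : 'I_k) : perm_invariant (tperm i j).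
  have [ts -> _] := prod_tpermP s.
  elim: ts => [|[i j] ts IH]; rewrite ?big_nil ?big_cons//.
  exact: perm_invariantM.
elim: k i j => [[]//|k IH] i j.
have liftP (a b : 'I_k) : perm_invariant (tperm (lift ord_max a) (lift ord_max b)).
  by rewrite tperm_lift_perm; exact/perm_invariant_lift/IH.
have maxP (a : 'I_k) : perm_invariant (tperm (lift ord_max a) ord_max).
  case: k IH liftP {i j} a => [|k] IH liftP a; first by case: a.
  have [->|am] := eqVneq a ord_max; first exact: perm_invariant_swap.
  have -> : tperm (lift ord_max a) ord_max =
     (tperm (lift ord_max a) (lift ord_max ord_max) *
      tperm (lift ord_max ord_max) ord_max *
      tperm (lift ord_max a) (lift ord_max ord_max))%g.
    set t := tperm (lift ord_max a) (lift ord_max ord_max).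
    rewrite -mulgA -{1}[t]tpermV -conjgE tpermJ tpermR.
    by rewrite tpermD// eq_sym neq_lift.
  apply: perm_invariantM => //; apply: perm_invariantM => //.
  exact: perm_invariant_swap.
case: (unliftP ord_max i) => [a|] ->; case: (unliftP ord_max j) => [b|] -> //.
  by rewrite tpermC.
by rewrite tperm1.
Qed.

End IteratedIntegral.

Section Positivity.
Variable R : realType.
Local Open Scope ereal_scope.
Local Notation leb := (@lebesgue_measure R).

Lemma lebesgue_int0 n : lebesgue_int (fun _ : n.-tuple R => 0) = 0.
Proof.
elim: n => //= n IH; rewrite -[RHS]IH; apply: eq_lebesgue_int => y.
exact: integral0_eq.
Qed.

(** If the integral vanished, [f] would be zero almost everywhere, although it is
    positive on the set [D] of positive measure. *)
Lemma integral_gt0 d (S : measurableType d) (mu : {measure set S -> \bar R})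
    (D E : set S) (f : S -> \bar R) :
  measurable E -> D `<=` E -> measurable D ->
  measurable_fun E f -> (forall x, E x -> 0 <= f x) ->
  (forall x, D x -> 0 < f x) -> 0 < mu D -> 0 < \int[mu]_(x in E) f x.
Proof.
move=> mE DE mD mf f0 fD muD.
rewrite lt0e integral_ge0// andbT; apply/eqP => int0.
have : ae_eq mu E f (cst 0).
  apply/ae_eq_integral_abs => //; rewrite -int0; apply: eq_integral => x.
  by rewrite inE => /f0 fx; rewrite gee0_abs.
move=> [N [mN muN fN]]; suff : mu D <= 0 by rewrite leNgt muD.
rewrite -muN; apply: le_measure; rewrite ?inE// => x Dx; apply: fN => /= fx.
by have := fD x Dx; rewrite fx/= ?ltxx//; exact: DE.
Qed.

Definition box n (a b : 'I_n -> R) : set (n.-tuple R) :=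
  [set x | forall i, (a i < tnth x i < b i)%R].

Lemma measurable_box n (a b : 'I_n -> R) : measurable (box a b).
Proof.
have -> : box a b = \bigcap_i ((@tnth n R)^~ i @^-1` `]a i, b i[).
  apply/seteqP; split=> [x xab i _|x xab i];
  by have := xab i; rewrite /= in_itv/=; exact.
apply: fin_bigcap_measurable => // i _.
by rewrite -[X in measurable X]setTI; apply: measurable_tnth.
Qed.

(** Along each coordinate in turn, the integrand is positive on an interval of
    positive length. *)
Lemma lebesgue_int_gt0 n (a b : 'I_n -> R) (f : n.-tuple R -> \bar R) :
  (forall i, (a i < b i)%R) -> measurable_fun setT f -> (forall x, 0 <= f x) ->
  (forall x, box a b x -> 0 < f x) -> 0 < lebesgue_int f.
Proof.
elim: n a b f => [|n IH] a b f ab mf f0 fpos /=; first by apply: fpos => -[].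
apply: (IH (a \o lift ord_max) (b \o lift ord_max)).
- by move=> i /=.
- exact: measurable_last_integral.
- by move=> y; exact: integral_ge0.
move=> y yab; apply: (@integral_gt0 _ _ leb
  (`]a ord_max, b ord_max[%classic : set R) setT) => //.
- by apply: (measurableT_comp mf); exact: measurable_rcons.
- move=> u /=; rewrite in_itv/= => uab; apply: fpos => i.
  case: (unliftP ord_max i) => [j|] ->; last by rewrite tnth_rcons_max.
  by rewrite tnth_rcons_lift; exact: yab.
- by rewrite /= lebesgue_measure_itv/= lte_fin ab -EFinD lte_fin subr_gt0.
Qed.

(** * Laws given by a density *)

Definition has_density d (T : measurableType d) (P : probability T R) n
    (V : T -> n.-tuple R) (h : n.-tuple R -> R) :=
  forall A, measurable A ->
    P (V @^-1` A) = lebesgue_int (fun x => (h x * \1_A x)%:E).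

(** The hypothesis on the law only concerns sets; the tail formula for
    expectations reduces [f] to its superlevel sets, and Tonelli then recombines
    them on the side of the density. *)
Lemma density_expectation d (T : measurableType d) (P : probability T R) n
    (V : T -> n.-tuple R) (h f : n.-tuple R -> R) (B : set (n.-tuple R)) :
  measurable_fun setT V -> measurable_fun setT h -> measurable_fun setT f ->
  (forall x, (0 <= h x)%R) -> (forall x, (0 <= f x)%R) ->
  has_density P V h -> measurable B ->
  \int[P]_(w in V @^-1` B) (f (V w))%:E =
  lebesgue_int (fun x => (h x * f x * \1_B x)%:E).
Proof.
move=> mV mh mf h0 f0 dV mB.
pose Y w : R := (f (V w) * \1_B (V w))%R.
have mY : measurable_fun setT Y.
  apply: measurable_funM; first exact: measurableT_comp.
  by apply: measurableT_comp => //; exact: measurable_indic.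
pose YRV : {RV P >-> R} := HB.pack Y (isMeasurableFun.Build _ _ _ _ Y mY).
have Y0 w : (0 <= YRV w)%R by rewrite mulr_ge0//.
transitivity ('E_P[YRV]).
  rewrite expectation_def integral_mkcond; apply: eq_integral => w _ /=.
  rewrite patchE /Y indicE; have [|] := boolP (w \in V @^-1` B).
    by rewrite inE/= => VB; rewrite mem_set// mulr1.
  by rewrite notin_setE/= => VB; rewrite memNset// mulr0.
rewrite ge0_expectation_ccdf//.
pose F (p : R * n.-tuple R) : \bar R :=
  (h p.2 * \1_B p.2 * \1_[set q : R * n.-tuple R | (0 <= q.1 < f q.2)%R] p)%:E.
have mS : measurable [set q : R * n.-tuple R | (0 <= q.1 < f q.2)%R].
  have mb : measurable_fun setT (fun q : R * n.-tuple R => (0 <= q.1 < f q.2)%R).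
    apply: measurable_and; first exact: measurable_fun_ler.
    by apply: measurable_fun_ltr => //; exact: measurableT_comp.
  by rewrite -[X in measurable X]setTI; exact: (mb _ [set true]).
have mF : measurable_fun setT F.
  apply/measurable_EFinP; apply: measurable_funM; last exact: measurable_indic.
  apply: measurable_funM; first exact: measurableT_comp.
  by apply: measurableT_comp => //; exact: measurable_indic.
have F0 p : 0 <= F p by rewrite lee_fin !mulr_ge0.
transitivity (\int[leb]_r lebesgue_int (fun x => F (r, x))).
  rewrite integral_mkcond; apply: eq_integral => r _; rewrite patchE.
  case: ifPn; rewrite ?inE ?notin_setE /= in_itv /= andbT.
    move=> r0; rewrite /ccdf /distribution /pushforward/=.
    have mfr : measurable (B `&` f @^-1` `]r, +oo[).
      by apply: measurableI => //; rewrite -[X in measurable X]setTI; exact: mf.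
    rewrite -[RHS](_ : P (V @^-1` (B `&` f @^-1` `]r, +oo[)) = _).
      congr (P _); apply/seteqP; split => w /=; rewrite !in_itv/= !andbT /Y indicE.
        have [VB|VB] := boolP (V w \in B); last by rewrite mulr0 ltNge r0.
        by rewrite mulr1; move: VB; rewrite inE.
      by move=> [VB rf]; rewrite mem_set// mulr1.
    rewrite dV//; apply: eq_lebesgue_int => x.
    rewrite /F indicI mulrA; congr ((_ * _)%:E).
    rewrite !indicE; congr (_%:R); congr (nat_of_bool _).
    by apply/idP/idP; rewrite !inE/= in_itv/= andbT r0.
  move=> /negP; rewrite -ltNge => r0; rewrite -[LHS](lebesgue_int0 n).
  apply: eq_lebesgue_int => x; rewrite /F [X in (_ * X)%R]indicE memNset ?mulr0//=.
  by rewrite leNgt r0.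
rewrite (lebesgue_int_fubini leb mF F0); apply: eq_lebesgue_int => x.
rewrite /F/=; under eq_integral do rewrite EFinM.
rewrite ge0_integralZl//=; last 2 first.
- apply/measurable_EFinP.
  apply: (measurableT_comp (measurable_indic mS)); exact: measurable_fun_pair.
- by rewrite lee_fin mulr_ge0.
rewrite -mulrA (mulrC (f x)) mulrA [RHS]EFinM; congr (_ * _)%E.
transitivity (\int[leb]_r (\1_(`[0%R, f x[%classic : set R) r)%:E).
  apply: eq_integral => r _; rewrite !indicE.
  by congr (EFin (GRing.natmul _ (nat_of_bool _))).
rewrite integral_indic// setIT /= lebesgue_measure_itv/= lte_fin.
case: ltP => [_|fx0]; first by rewrite sube0.
by congr EFin; apply/eqP; rewrite eq_le fx0 f0.
Qed.

End Positivity.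

(** * Tails of the normal distribution *)

Section NormalTail.
Variables (R : realType) (s t : R).
Hypothesis s0 : s != 0.
Local Notation leb := (@lebesgue_measure R).

Lemma normal_pdf_peak (m x : R) :
  normal_pdf m s x = normal_peak s * normal_fun m s x.
Proof. by rewrite normal_pdfE. Qed.

Definition normal_tail (z : R) : R := fine (normal_prob z s `[t, +oo[).

Lemma normal_tailE z : (normal_tail z)%:E = normal_prob z s `[t, +oo[.
Proof. by rewrite /normal_tail fineK// fin_num_measure. Qed.

Lemma normal_tail_ge0 z : 0 <= normal_tail z.
Proof. exact/fine_ge0. Qed.

(** Translation by [z]: with the mean fixed to [0], tails for different means
    become measures of nested half-lines under one law. *)
Lemma normal_prob_shift z :
  normal_prob z s `[t, +oo[ = normal_prob 0 s `[t - z, +oo[.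
Proof.
pose F (x : R) := x + z.
have dF : F^`()%classic = cst 1.
  apply/funext => x; rewrite /F derive1E deriveD// derive_id derive_cst addr0//.
rewrite /normal_prob.
have -> : `[t, +oo[%classic = `[F (t - z), +oo[%classic :> set R.
  by rewrite /F subrK.
rewrite increasing_ge0_integration_by_substitutiony//.
- apply: eq_integral => x _; rewrite dF /= mulr1.
  have Fx : F x - z = x by exact: addrK.
  by rewrite /comp !normal_pdf_peak /normal_fun Fx subr0.
- by move=> x y _ _ xy; rewrite /F ltrD2r.
- by rewrite dF => x _; exact: cvg_cst.
- by rewrite dF; exact: is_cvg_cst.
- by rewrite dF; exact: is_cvg_cst.
- split=> [x _|]; first exact: derivableD.
  apply: cvg_at_right_filter; apply: cvgD; [exact: cvg_id|exact: cvg_cst].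
- exact: cvg_addrr.
- apply: continuous_subspaceT; exact: continuous_normal_pdf.
- by move=> x _; exact: normal_pdf_ge0.
Qed.

Lemma normal_tail_diff z z' : z < z' ->
  (normal_tail z' - normal_tail z)%:E = normal_prob 0 s `[t - z', t - z[.
Proof.
move=> zz'; rewrite EFinB !normal_tailE !normal_prob_shift.
have -> : `[t - z', +oo[%classic =
    `[t - z', t - z[%classic `|` `[t - z, +oo[%classic :> set R.
  apply/seteqP; split=> u /=; rewrite !in_itv/= !andbT.
    by move=> ->; have [] := ltP u (t - z); [left|right].
  by move=> [/andP[]//|]; apply: le_trans; lra.
rewrite measureU//; first by rewrite addeK// fin_num_measure.
apply/seteqP; split=> u //=; rewrite !in_itv/= andbT => -[/andP[_ ut]].
by rewrite leNgt ut.
Qed.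

(** The difference is the mass that the centered law gives to a nonempty interval;
    the normal density is positive there. *)
Lemma normal_tail_lt z z' : z < z' -> normal_tail z < normal_tail z'.
Proof.
move=> zz'; rewrite -subr_gt0 -lte_fin normal_tail_diff//.
apply: (@integral_gt0 _ _ _ leb `[t - z', t - z[%classic) => //.
- by apply/measurable_EFinP/measurable_funTS; exact: measurable_normal_pdf.
- by move=> u _; rewrite lee_fin normal_pdf_ge0.
- move=> u _; rewrite lte_fin normal_pdf_peak.
  by rewrite mulr_gt0 ?expR_gt0 ?normal_peak_gt0.
- by rewrite /= lebesgue_measure_itv/= lte_fin ltrD2l ltrN2 zz' -EFinB lte_fin; lra.
Qed.

Lemma normal_tail_le z z' : (normal_tail z <= normal_tail z') = (z <= z').
Proof. by apply: le_mono; exact: normal_tail_lt. Qed.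

(** The normal density is bounded by its value at the mean. *)
Lemma normal_tail_lipschitz z z' : z < z' ->
  normal_tail z' - normal_tail z <= normal_peak s * (z' - z).
Proof.
move=> zz'; rewrite -lee_fin normal_tail_diff// /normal_prob.
apply: (@le_trans _ _
  (\int[leb]_(u in `[(t - z')%R, (t - z)%R[) (normal_peak s)%:E)%E).
  apply: ge0_le_integral => //=.
  - by move=> x _; rewrite lee_fin normal_pdf_ge0.
  - by apply/measurable_EFinP/measurable_funTS; exact: measurable_normal_pdf.
  - by move=> x _; rewrite lee_fin; exact: normal_pdf_ub.
rewrite integral_cst//= lebesgue_measure_itv/= lte_fin ltrD2l ltrN2 zz'.
rewrite -EFinB -EFinM.
by rewrite lee_fin; apply: ler_wpM2l; [exact: normal_peak_ge0|lra].
Qed.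

Lemma continuous_normal_tail : continuous normal_tail.
Proof.
have L x y : `|normal_tail x - normal_tail y| <= normal_peak s * `|x - y|.
  wlog xy : x y / y < x => [H|].
    have [/H//|xy|->] := ltgtP y x; last by rewrite !subrr normr0 mulr0.
    by rewrite distrC (distrC x y); exact: H.
  have yx := ltW xy.
  rewrite (@ger0_norm _ (x - y)) ?subr_ge0//.
  rewrite ger0_norm ?subr_ge0 ?normal_tail_le//.
  exact: normal_tail_lipschitz.
move=> x; apply/cvgrPdist_lt => e e0; near=> y.
apply: le_lt_trans (L _ _) _.
rewrite mulrC -ltr_pdivlMr ?normal_peak_gt0//.
near: y; apply: cvgr_dist_lt; first exact: cvg_id.
by apply: divr_gt0 => //; exact: normal_peak_gt0.
Unshelve. all: by end_near. Qed.

Lemma measurable_normal_tail : measurable_fun setT normal_tail.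
Proof. by apply: continuous_measurable_fun; exact: continuous_normal_tail. Qed.

Lemma normal_tail_gt0 z : 0 < normal_tail z.
Proof.
have z1 : z - 1 < z by lra.
exact: le_lt_trans (normal_tail_ge0 (z - 1)) (normal_tail_lt z1).
Qed.

End NormalTail.

(** * Gaussian densities and conditional tails *)

Section GaussianDensity.
Variable R : realType.
Local Notation leb := (@lebesgue_measure R).

Definition quad n (K : 'M[R]_n) (x : n.-tuple R) : R :=
  \sum_(i < n) \sum_(j < n) tnth x i * K i j * tnth x j.

(** Only the positivity of the constant [c] matters, so it is left free and no
    determinant has to be followed when coordinates are integrated out. *)
Definition gauss_weight n (c : R) (K : 'M[R]_n) (x : n.-tuple R) : R :=
  c * expR (- (2^-1 * quad K x)).

Definition gaussian_law d (T : measurableType d) (P : probability T R) n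
    (V : T -> n.-tuple R) (K : 'M[R]_n) :=
  exists2 c, 0 < c & has_density P V (gauss_weight c K).

Lemma measurable_gauss_weight n c (K : 'M[R]_n) :
  measurable_fun setT (gauss_weight c K).
Proof.
apply: measurable_funM => //; apply: measurableT_comp => //.
apply: measurableT_comp => //; apply: measurable_funM => //.
apply: measurable_sum => i; apply: measurable_sum => j.
by apply: measurable_funM; [apply: measurable_funM => //|]; exact: measurable_tnth.
Qed.

Lemma gauss_weight_gt0 n c (K : 'M[R]_n) x : 0 < c -> 0 < gauss_weight c K x.
Proof. by move=> c0; rewrite mulr_gt0// expR_gt0. Qed.

Lemma gaussian_law_box_gt0 d (T : measurableType d) (P : probability T R) n
    (V : T -> n.-tuple R) (K : 'M[R]_n) (a b : 'I_n -> R) :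
  gaussian_law P V K -> (forall i, a i < b i) -> (0 < P (V @^-1` box a b))%E.
Proof.
move=> [c c0 dV] ab; rewrite dV; last exact: measurable_box.
apply: (lebesgue_int_gt0 ab).
- apply/measurable_EFinP; apply: measurable_funM.
    exact: measurable_gauss_weight.
  by apply: measurable_indic; exact: measurable_box.
- by move=> x; rewrite lee_fin mulr_ge0// ltW// gauss_weight_gt0.
- by move=> x abx; rewrite lte_fin indicE mem_set// mulr1 gauss_weight_gt0.
Qed.

(** The constant of [gaussian_pdf] is nonnegative by construction; it cannot be
    zero because the whole space has probability one. *)
Lemma gaussian_law_init d (T : measurableType d) (P : probability T R) n
    (X : 'I_n -> {RV P >-> R}) (S : 'M[R]_n) :
  centered_gaussian X S ->
  gaussian_law P (fun w => [tuple X i w | i < n]) (invmx S).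
Proof.
move=> gX; pose c : R := (Num.sqrt ((2 * pi) ^+ n * \det S))^-1.
exists c; last by move=> A mA; rewrite -gX.
rewrite lt0r invr_ge0 sqrtr_ge0 andbT; apply/eqP => c0.
have := gX setT measurableT.
rewrite [X in P X](_ : _ = setT) ?probability_setT; last by apply/seteqP.
rewrite (_ : lebesgue_int _ = 0%E); first by move=> /eqP; rewrite onee_eq0.
rewrite -[RHS](@lebesgue_int0 R n); apply: eq_lebesgue_int => x.
by rewrite /gaussian_pdf -/c c0 !mul0r.
Qed.

Lemma quad_perm n (s : 'S_n) (K : 'M[R]_n) x :
  quad (mxsub s s K) (perm_tuple s x) = quad K x.
Proof.
rewrite /quad [RHS](reindex_perm s); apply: eq_bigr => i _.
rewrite [RHS](reindex_perm s); apply: eq_bigr => j _.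
by rewrite !tnth_mktuple mxE.
Qed.

Lemma gaussian_law_perm d (T : measurableType d) (P : probability T R) n
    (V : T -> n.-tuple R) (K : 'M[R]_n) (s : 'S_n) :
  gaussian_law P V K -> gaussian_law P (perm_tuple s \o V) (mxsub s s K).
Proof.
move=> [c c0 dV]; exists c => // A mA.
rewrite comp_preimage dV; last first.
  by rewrite -[X in measurable X]setTI; exact: measurable_perm_tuple.
rewrite -[RHS](lebesgue_int_perm s); first last.
- by move=> x; rewrite lee_fin mulr_ge0// ltW// gauss_weight_gt0.
- apply/measurable_EFinP; apply: measurable_funM.
    exact: measurable_gauss_weight.
  exact: measurable_indic.
by apply: eq_lebesgue_int => x /=; rewrite /gauss_weight quad_perm.
Qed.

Lemma sum_lift_max (V : nmodType) n (F : 'I_n.+1 -> V) :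
  \sum_(i < n.+1) F i = \sum_(j < n) F (lift ord_max j) + F ord_max.
Proof.
rewrite big_ord_recr/=; congr +%R; apply: eq_bigr => j _; congr F.
by apply: ord_inj; rewrite lift_max.
Qed.

Section LastCoordinate.
Variables (n : nat) (K : 'M[R]_n.+1).
Hypothesis Ksym : forall i j, K i j = K j i.
Hypothesis Kmax : 0 < K ord_max ord_max.

Definition schur : 'M[R]_n := \matrix_(i, j)
  (K (lift ord_max i) (lift ord_max j) -
   K (lift ord_max i) ord_max * K ord_max (lift ord_max j) / K ord_max ord_max).

(** The coefficient of [y_j] in the linear regression of the last coordinate on
    the others. *)
Definition reg_coef (j : 'I_n) : R :=
  - K ord_max (lift ord_max j) / K ord_max ord_max.

Definition cond_mean (y : n.-tuple R) : R := \sum_(j < n) reg_coef j * tnth y j.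

Definition cond_sd : R := Num.sqrt (K ord_max ord_max)^-1.

Lemma cond_sd_neq0 : cond_sd != 0.
Proof. by rewrite gt_eqF// sqrtr_gt0 invr_gt0. Qed.

(** Completing the square in the last coordinate. *)
Lemma quad_rcons (y : n.-tuple R) u : quad K [tuple of rcons y u] =
  quad schur y + K ord_max ord_max * (u - cond_mean y) ^+ 2.
Proof.
pose Q := \sum_(i < n) \sum_(j < n)
  tnth y i * K (lift ord_max i) (lift ord_max j) * tnth y j.
pose b := \sum_(j < n) K ord_max (lift ord_max j) * tnth y j.
set a := K ord_max ord_max.
have a0 : a != 0 by rewrite gt_eqF.
have -> : quad K [tuple of rcons y u] = Q + 2 * u * b + a * u ^+ 2.
  rewrite /quad sum_lift_max sum_lift_max !tnth_rcons_max.
  under eq_bigr do rewrite sum_lift_max tnth_rcons_lift tnth_rcons_max.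
  rewrite big_split/=.
  have -> : \sum_(i < n) tnth y i * K (lift ord_max i) ord_max * u = u * b.
    rewrite mulr_sumr; apply: eq_bigr => i _.
    by rewrite (Ksym (lift _ _)); ring.
  have -> : \sum_(j < n) u * K ord_max (lift ord_max j) *
      tnth [tuple of rcons y u] (lift ord_max j) = u * b.
    rewrite mulr_sumr; apply: eq_bigr => i _.
    by rewrite tnth_rcons_lift; ring.
  rewrite (_ : \sum_(i < n) _ = Q); first by rewrite -/a; ring.
  by apply: eq_bigr => i _; apply: eq_bigr => j _; rewrite tnth_rcons_lift.
have -> : quad schur y = Q - b ^+ 2 / a.
  rewrite /quad /Q expr2 mulrAC {1}/b mulr_suml mulr_suml.
  rewrite -sumrB; apply: eq_bigr => i _; rewrite /b !mulr_sumr -sumrB.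
  by apply: eq_bigr => j _; rewrite mxE (Ksym (lift ord_max i) ord_max) -/a; ring.
have -> : cond_mean y = - b / a.
  rewrite /cond_mean /b -sumrN mulr_suml; apply: eq_bigr => j _.
  by rewrite /reg_coef -/a; ring.
by field.
Qed.

Lemma gauss_weight_rcons c (y : n.-tuple R) u :
  gauss_weight c K [tuple of rcons y u] =
  gauss_weight (c / normal_peak cond_sd) schur y *
  normal_pdf (cond_mean y) cond_sd u.
Proof.
rewrite normal_pdf_peak ?cond_sd_neq0// /gauss_weight quad_rcons.
have p0 : normal_peak cond_sd != 0.
  by rewrite gt_eqF// normal_peak_gt0// cond_sd_neq0.
rewrite mulrDr opprD expRD /normal_fun /cond_sd sqr_sqrtr ?invr_ge0 ?ltW//.
rewrite (_ : - (_ - _) ^+ 2 / _ =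
    - (2^-1 * (K ord_max ord_max * (u - cond_mean y) ^+ 2))).
  by field.
by field; rewrite gt_eqF.
Qed.

Section Law.
Variables (d : measure_display) (T : measurableType d) (P : probability T R).
Variables (V : T -> n.-tuple R) (U : T -> R) (c : R).
Hypothesis c0 : 0 < c.
Hypothesis dVU :
  has_density P (fun w => [tuple of rcons (V w) (U w)]) (gauss_weight c K).

(** Integrating the factorisation of [gauss_weight_rcons] over the last
    coordinate: for [D] the whole line it yields the law of [V], for [D] a
    half-line the conditional tail. *)
Lemma gaussian_split (B : set (n.-tuple R)) (D : set R) :
  measurable B -> measurable D ->
  P (V @^-1` B `&` U @^-1` D) =
  lebesgue_int (fun y => (gauss_weight (c / normal_peak cond_sd) schur y *
    fine (normal_prob (cond_mean y) cond_sd D) * \1_B y)%:E).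
Proof.
move=> mB mD.
pose bl (x : n.+1.-tuple R) := [tuple tnth x (lift ord_max j) | j < n].
have mbl : measurable_fun setT bl.
  apply/measurable_fun_tnthP => i.
  rewrite [X in measurable_fun _ X](_ : _ = (@tnth _ R)^~ (lift ord_max i)).
    exact: measurable_tnth.
  by apply/funext => x /=; rewrite tnth_mktuple.
have blE (y : n.-tuple R) u : bl [tuple of rcons y u] = y.
  by apply: eq_from_tnth => i; rewrite tnth_mktuple tnth_rcons_lift.
pose A := bl @^-1` B `&` (@tnth _ R)^~ ord_max @^-1` D.
have mA : measurable A.
  apply: measurableI; rewrite -[X in measurable X]setTI; first exact: mbl.
  exact: measurable_tnth.
have -> : V @^-1` B `&` U @^-1` D = (fun w => [tuple of rcons (V w) (U w)]) @^-1` A.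
  by apply/seteqP; split => w; rewrite /A /= blE tnth_rcons_max.
rewrite dVU//=; apply: eq_lebesgue_int => y.
have -> : \1_A = (fun x => \1_B (bl x) * \1_D (tnth x ord_max)) :> (_ -> R).
  by apply/funext => x; rewrite /A indicI.
set h := gauss_weight _ schur y.
have h0 : 0 <= h.
  by rewrite ltW// gauss_weight_gt0// divr_gt0// normal_peak_gt0// cond_sd_neq0.
transitivity (\int[leb]_u ((h * \1_B y)%:E *
    (normal_pdf (cond_mean y) cond_sd u * \1_D u)%:E))%E.
  apply: eq_integral => u _; rewrite gauss_weight_rcons blE tnth_rcons_max -/h.
  by rewrite -EFinM; congr EFin; ring.
rewrite ge0_integralZl//=; last 3 first.
- apply/measurable_EFinP; apply: measurable_funM.
    exact: measurable_normal_pdf.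
  exact: measurable_indic.
- by move=> u _; rewrite lee_fin mulr_ge0// normal_pdf_ge0.
- by rewrite lee_fin mulr_ge0.
rewrite [in RHS]mulrAC [RHS]EFinM; congr (_ * _)%E.
rewrite fineK ?fin_num_measure// /normal_prob [RHS]integral_mkcond.
apply: eq_integral => u _; rewrite patchE indicE.
by case: ifP; rewrite ?mulr1 ?mulr0.
Qed.

Lemma density_schur :
  has_density P V (gauss_weight (c / normal_peak cond_sd) schur).
Proof.
move=> B mB; rewrite -[X in P X]setIT -(preimage_setT U) gaussian_split//.
by apply: eq_lebesgue_int => y; rewrite probability_setT mulr1.
Qed.

Lemma gaussian_law_schur : gaussian_law P V schur.
Proof.
exists (c / normal_peak cond_sd); last exact: density_schur.
by rewrite divr_gt0// normal_peak_gt0// cond_sd_neq0.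
Qed.

Lemma cond_tail_identity t (B : set (n.-tuple R)) :
  measurable_fun setT V -> measurable B ->
  P ([set w | t <= U w] `&` V @^-1` B) =
  (\int[P]_(w in V @^-1` B) (normal_tail cond_sd t (cond_mean (V w)))%:E)%E.
Proof.
move=> mV mB.
have -> : [set w | t <= U w] = U @^-1` `[t, +oo[.
  by apply/seteqP; split=> w /=; rewrite in_itv/= andbT.
rewrite setIC gaussian_split//.
have mcond : measurable_fun setT cond_mean.
  apply: measurable_sum => j; apply: measurable_funM => //.
  exact: measurable_tnth.
rewrite (@density_expectation _ _ _ P _ V
  (gauss_weight (c / normal_peak cond_sd) schur)
  (fun y => normal_tail cond_sd t (cond_mean y)))//.
- exact: measurable_gauss_weight.
- apply: measurableT_comp => //; apply: measurable_normal_tail.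
  exact: cond_sd_neq0.
- move=> x; rewrite ltW// gauss_weight_gt0// divr_gt0// normal_peak_gt0//.
  exact: cond_sd_neq0.
- move=> x; exact: normal_tail_ge0.
- exact: density_schur.
Qed.

End Law.
End LastCoordinate.
End GaussianDensity.

(** * Integral bounds for possibly nonmeasurable functions *)

Section IntegralBounds.
Local Open Scope ereal_scope.
Context d (T : measurableType d) (R : realType) (mu : {measure set T -> \bar R}).
Implicit Types (D : set T) (f g : T -> \bar R).

(** The integral of a nonnegative function is a supremum over the simple functions
    below it, which is monotone without any measurability.  The versions [g] in the
    definition of CIS are not given as measurable functions, so the bounds below
    are needed in this generality. *)
Lemma ge0_le_integral_nonmeasurable D f g : (forall x, D x -> 0 <= f x) ->
  (forall x, D x -> f x <= g x) -> \int[mu]_(x in D) f x <= \int[mu]_(x in D) g x.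
Proof.
move=> f0 fg; rewrite integral_mkcond [leRHS]integral_mkcond.
have fD0 x : 0 <= (f \_ D) x by rewrite patchE; case: ifPn => // /[!inE] /f0.
have fgD x : (f \_ D) x <= (g \_ D) x.
  by rewrite !patchE; case: ifPn => // /[!inE] /fg.
rewrite !ge0_integralTE//; last by move=> x; exact: le_trans (fgD x).
apply: le_ereal_sup => _ [h hf <-]; exists h => // x.
exact: le_trans (hf x) (fgD x).
Qed.

Lemma integral_le_cst D f (c : R) : measurable D -> (0 <= c)%R ->
  (forall x, D x -> f x <= c%:E) -> \int[mu]_(x in D) f x <= c%:E * mu D.
Proof.
move=> mD c0 fc; rewrite -(integral_cst mu mD c%:E) integralE.
apply: (@le_trans _ _ (\int[mu]_(x in D) f^\+ x)).
  by rewrite geeDl// oppe_le0 integral_ge0.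
apply: ge0_le_integral_nonmeasurable => x Dx //.
by rewrite funeposE ge_max fc//= lee_fin.
Qed.

Lemma integral_ge_cst D f (c : R) : measurable D -> (0 <= c)%R ->
  (forall x, D x -> c%:E <= f x) -> c%:E * mu D <= \int[mu]_(x in D) f x.
Proof.
move=> mD c0 fc; rewrite -(integral_cst mu mD c%:E).
exact: ge0_le_integral_nonmeasurable.
Qed.

End IntegralBounds.

(** * Laws of the initial segments of an ordering *)

Section Prefix.
Variables (d : measure_display) (T : measurableType d) (R : realType).
Variables (P : probability T R) (m : nat) (X : 'I_m -> {RV P >-> R}).
Variable S : 'M[R]_m.
Hypothesis Spd : posdef S.
Hypothesis gX : centered_gaussian X S.
Variable s : 'S_m.

Definition prefix_map k (km : (k <= m)%N) (j : 'I_k) : 'I_m := s (widen_ord km j).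

Lemma prefix_map_inj k (km : (k <= m)%N) : injective (prefix_map km).
Proof. by move=> i j /perm_inj /(congr1 val) /= /val_inj. Qed.

Definition prefix_prec k (km : (k <= m)%N) : 'M[R]_k :=
  mxsub (prefix_map km) (prefix_map km)
    (prec S [set prefix_map km j | j : 'I_k]%SET).

Lemma prefix_prec_sym k (km : (k <= m)%N) i j :
  prefix_prec km i j = prefix_prec km j i.
Proof. by rewrite !mxE prec_sym. Qed.

Lemma prefix_prec_gt0 k (km : (k <= m)%N) i : 0 < prefix_prec km i i.
Proof. by rewrite mxE prec_gt0. Qed.

Lemma prefix_map_lift k (km : (k.+1 <= m)%N) j :
  prefix_map km (lift ord_max j) = prefix_map (ltnW km) j.
Proof. by congr (s _); apply: ord_inj; rewrite /= -[RHS]lift_max. Qed.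

Lemma schur_prefix_prec k (km : (k.+1 <= m)%N) :
  schur (prefix_prec km) = prefix_prec (ltnW km).
Proof.
have inj := @prefix_map_inj _ km.
have OE : [set prefix_map (ltnW km) j | j : 'I_k]%SET =
    ([set prefix_map km j | j : 'I_k.+1] :\ prefix_map km ord_max)%SET.
  apply/setP => x; rewrite in_setD1.
  apply/imsetP/andP => [[j _ ->]|[xm /imsetP[i _ xi]]].
    by rewrite -prefix_map_lift (inj_eq inj) eq_sym neq_lift imset_f.
  move: xm; rewrite xi; case: (unliftP ord_max i) => [j|] ->; last by rewrite eqxx.
  by exists j; rewrite ?prefix_map_lift.
apply/matrixP => i j; rewrite !mxE OE -!prefix_map_lift prec_drop//.
- by rewrite imset_f.
- by rewrite (inj_eq inj) eq_sym neq_lift.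
- by rewrite (inj_eq inj) eq_sym neq_lift.
Qed.

(** Starting from the law of the whole permuted vector, the last coordinates are
    integrated out one at a time. *)
Lemma gaussian_law_prefix k (km : (k <= m)%N) :
  gaussian_law P (fun w => [tuple X (prefix_map km j) w | j < k]) (prefix_prec km).
Proof.
have [e ke] : exists e, (k + e = m)%N by exists (m - k)%N; rewrite subnKC.
elim: e k km ke => [|e IH] k km ke.
  have kE : k = m by rewrite -ke addn0.
  move: km {ke}; rewrite kE => km.
  have wE j : widen_ord km j = j by exact: val_inj.
  have := gaussian_law_perm s (gaussian_law_init gX); congr gaussian_law.
    apply/funext => w /=; apply: eq_from_tnth => j.
    by rewrite !tnth_mktuple /prefix_map wE.
  apply/matrixP => i j; rewrite !mxE /prefix_map !wE.
  rewrite (_ : [set _ | _ : _]%SET = [set: 'I_m]%SET) ?/prec ?padT//.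
  apply/setP => x; rewrite !inE; apply/imsetP; exists (s^-1 x)%g => //.
  by rewrite wE permKV.
have km' : (k.+1 <= m)%N by rewrite -ke addnS ltnS leq_addr.
have [|c c0 dV] := IH _ km'; first by rewrite addSnnS.
rewrite (_ : km = ltnW km') -?schur_prefix_prec; last exact: bool_irrelevance.
apply: (@gaussian_law_schur _ _ _ _ _ _ _ _ _
  (fun w => X (prefix_map km' ord_max) w) _ c0).
- exact: prefix_prec_sym.
- exact: prefix_prec_gt0.
rewrite (_ : (fun w => _) = fun w => [tuple X (prefix_map km' j) w | j < k.+1])//.
apply/funext => w; apply/esym/eq_rcons_tuple => [j|]; rewrite tnth_mktuple//.
by rewrite tnth_mktuple prefix_map_lift.
Qed.

Section At.
Variable i : 'I_m.
Let km : (i.+1 <= m)%N := ltn_ord i.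
Local Notation V := (predecessors (fun j => permuted X s j : T -> R) i).
Local Notation K := (prefix_prec km).

Lemma prefix_map_max : prefix_map km ord_max = s i.
Proof. by congr (s _); apply: val_inj. Qed.

Lemma predecessorsE : V = fun w => [tuple X (prefix_map (ltnW km) j) w | j < i].
Proof. by []. Qed.

Lemma prefix_set_imset : prefix_set s i = [set prefix_map km j | j : 'I_i.+1]%SET.
Proof.
apply/setP => x; apply/imsetP/imsetP => [[j]|[j _ ->]].
  rewrite inE => ji ->; have ji' : (j < i.+1)%N by [].
  by exists (Ordinal ji') => //; congr (s _); apply: val_inj.
by exists (widen_ord km j); rewrite ?inE//= -ltnS.
Qed.

Lemma prefix_law_rcons :
  gaussian_law P (fun w => [tuple of rcons (V w) (permuted X s i w)]) K.
Proof.
have := gaussian_law_prefix km; congr gaussian_law; apply/funext => w.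
apply: eq_rcons_tuple => [j|]; rewrite tnth_mktuple.
  by rewrite predecessorsE tnth_mktuple prefix_map_lift.
by rewrite prefix_map_max.
Qed.

Lemma law_predecessors : gaussian_law P V (prefix_prec (ltnW km)).
Proof. by rewrite predecessorsE; exact: gaussian_law_prefix. Qed.

Lemma measurable_predecessors : measurable_fun setT V.
Proof.
apply/measurable_fun_tnthP => j.
rewrite [X in measurable_fun _ X](_ : _ = (X (prefix_map (ltnW km) j) : T -> R)).
  exact: measurable_funPT.
by apply/funext => w /=; rewrite tnth_mktuple.
Qed.

Lemma predecessors_tail t (B : set (i.-tuple R)) : measurable B ->
  P ([set w | t <= permuted X s i w] `&` V @^-1` B) =
  (\int[P]_(w in V @^-1` B) (normal_tail (cond_sd K) t (cond_mean K (V w)))%:E)%E.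
Proof.
have [c c0 dV] := prefix_law_rcons.
apply: (cond_tail_identity _ _ c0) => //.
- exact: prefix_prec_sym.
- exact: prefix_prec_gt0.
- exact: measurable_predecessors.
Qed.

(** Division by the positive diagonal entry turns the sign of the last row of the
    precision matrix into the sign of the regression coefficients. *)
Lemma cand_prefixP :
  s i \in cand S (prefix_set s i) <-> forall j, 0 <= reg_coef K j.
Proof.
have K0 : 0 < (K ord_max ord_max)^-1 by rewrite invr_gt0 prefix_prec_gt0.
have regE j : (0 <= reg_coef K j) =
    (prec S (prefix_set s i) (s i) (prefix_map km (lift ord_max j)) <= 0).
  rewrite /reg_coef pmulr_lge0// oppr_ge0 mxE prefix_map_max.
  by rewrite prefix_set_imset.
split=> [/candP[_ sle] j|Kge].
  rewrite regE sle//; first by rewrite prefix_set_imset imset_f.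
  by rewrite -prefix_map_max (inj_eq (@prefix_map_inj _ km)) eq_sym neq_lift.
apply/candP; split; first by rewrite prefix_set_imset -prefix_map_max imset_f.
move=> b; rewrite {1}prefix_set_imset => /imsetP[j _ ->].
case: (unliftP ord_max j) => [k|] ->; first by move=> _; rewrite -regE.
by rewrite prefix_map_max eqxx.
Qed.

End At.
End Prefix.

(** * Monotone versions of a conditional tail *)

(** Change the coordinates of [y] into those of [z] one at a time. *)
Lemma nondecreasing_coordinatewise_le (R : realType) n (g : n.-tuple R -> R) y z :
  nondecreasing_coordinatewise g -> (forall j, tnth y j <= tnth z j) -> g y <= g z.
Proof.
move=> gmono yz.
pose h k := [tuple if (j < k)%N then tnth z j else tnth y j | j < n].
have hS k : (k <= n)%N -> g (h 0) <= g (h k).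
  elim: k => [//|k IH] kn; apply: le_trans (IH (ltnW kn)) _.
  apply: (gmono (Ordinal kn)) => [j jk|]; rewrite !tnth_mktuple /= ?ltnn ?ltnSn//.
  move: jk; rewrite -(inj_eq val_inj)/= => /negbTE jk.
  by rewrite ltnS [in RHS]leq_eqVlt jk.
have := hS n (leqnn n); congr (g _ <= g _); apply: eq_from_tnth => j.
  by rewrite tnth_mktuple.
by rewrite tnth_mktuple ltn_ord.
Qed.

Section MonotoneVersion.
Variables (d : measure_display) (T : measurableType d) (R : realType).
Variables (P : probability T R) (n : nat) (V : T -> n.-tuple R).
Variables (F : R -> R) (beta : 'I_n -> R) (g : n.-tuple R -> R).
Hypothesis mV : measurable_fun setT V.
Hypothesis Fmono : forall x y, x < y -> F x < F y.
Hypothesis F0 : forall x, 0 < F x.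
Hypothesis gmono : nondecreasing_coordinatewise g.
Hypothesis box0 : forall a b, (forall i, a i < b i) -> (0 < P (V @^-1` box a b))%E.
Hypothesis gF : forall B, measurable B ->
  (\int[P]_(w in V @^-1` B) (g (V w))%:E)%E =
  (\int[P]_(w in V @^-1` B) (F (\sum_(j < n) beta j * tnth (V w) j))%:E)%E.

(** Suppose [beta k < 0].  The point with all coordinates [e] lies above the box
    [B1] around the origin and below the box [B2] near the [k]-th basis vector,
    so the value [gam] of [g] at this point bounds [g] from above on [B1] and from
    below on [B2], and likewise for the averages.  For small [e] the linear form
    is larger on [B1] than on [B2], so the averages of [F] compare strictly in the
    opposite direction, although they equal those of [g]. *)
Lemma monotone_version_coef_ge0 k : 0 <= beta k.
Proof.
have Fle x y : x <= y -> F x <= F y.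
  by rewrite le_eqVlt => /predU1P[->//|/Fmono/ltW].
rewrite leNgt; apply/negP => bk.
(* The linear form is within [e * M] of [0] on [B1] and within [3 * e * M] of
   [beta k] on [B2]; this choice of [e] makes the sum of both errors half of
   [- beta k].  The added [1] keeps [M] positive. *)
pose M : R := \sum_j `|beta j| + 1.
have M0 : 0 < M by rewrite ltr_wpDl// sumr_ge0.
pose e : R := - beta k / (8 * M).
have e0 : 0 < e by rewrite divr_gt0 ?oppr_gt0 ?mulr_gt0.
have eM : e * M = - beta k / 8 by rewrite /e; field; rewrite gt_eqF.
pose lin (y : n.-tuple R) := \sum_(j < n) beta j * tnth y j.
have lin_le (y : n.-tuple R) (x : 'I_n -> R) r : 0 <= r ->
    (forall j, `|tnth y j - x j| <= r) ->
    `|lin y - \sum_j beta j * x j| <= r * M.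
  move=> r0 yx; rewrite /lin -sumrB (le_trans (ler_norm_sum _ _ _))//.
  rewrite mulrDr mulr1 ler_wpDr// mulr_sumr ler_sum// => j _.
  by rewrite -mulrBr normrM mulrC ler_wpM2r.
pose B1 := box (fun=> - e) (fun _ : 'I_n => e).
pose a2 (j : 'I_n) : R := (j == k)%:R + e.
pose b2 (j : 'I_n) : R := (j == k)%:R + 3 * e.
pose B2 := box a2 b2.
have mB1 : measurable B1 by exact: measurable_box.
have mB2 : measurable B2 by exact: measurable_box.
have mVB B : measurable B -> measurable (V @^-1` B).
  by move=> mB; rewrite -[X in measurable X]setTI; exact: mV.
have p1 : (0 < P (V @^-1` B1))%E by apply: box0 => j; lra.
have p2 : (0 < P (V @^-1` B2))%E by apply: box0 => j; rewrite /a2 /b2; lra.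
have f1 : P (V @^-1` B1) \is a fin_num by rewrite fin_num_measure//; exact: mVB.
have f2 : P (V @^-1` B2) \is a fin_num by rewrite fin_num_measure//; exact: mVB.
pose gam := g [tuple e | j < n].
have g1 y : B1 y -> g y <= gam.
  move=> yB; apply: nondecreasing_coordinatewise_le => // j.
  by rewrite tnth_mktuple; case/andP: (yB j) => _ /ltW.
have g2 y : B2 y -> gam <= g y.
  move=> yB; apply: nondecreasing_coordinatewise_le => // j.
  rewrite tnth_mktuple; case/andP: (yB j) => /ltW + _; apply: le_trans.
  by rewrite /a2 lerDr.
have l1 y : B1 y -> - (e * M) <= lin y.
  move=> yB; have := lin_le y (fun=> 0) e (ltW e0).
  under eq_bigr do rewrite mulr0; rewrite big1// subr0 => H.
  have := H _; rewrite ler_norml => /(_ _)/andP[] // j.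
  by rewrite subr0 ler_norml; case/andP: (yB j) => /ltW-> /ltW->.
have l2 y : B2 y -> lin y <= beta k + 3 * e * M.
  move=> yB; have e3 : 0 <= 3 * e by lra.
  have := lin_le y (fun j => (j == k)%:R) _ e3.
  rewrite (bigD1 k)//= eqxx mulr1 big1 ?addr0 => [H|j /negbTE ->]; last first.
    by rewrite mulr0.
  suff : lin y - beta k <= 3 * e * M by rewrite lerBlDl.
  apply: le_trans (ler_norm _) (H _) => j.
  rewrite ler_norml; case/andP: (yB j); rewrite /a2 /b2 => h1 h2.
  by apply/andP; split; lra.
(* [gam] is not known to be nonnegative, which the bound on a possibly
   nonmeasurable integrand requires, hence the maximum; positivity of [gam]
   follows because [F] is positive. *)
have F1g : F (- (e * M)) <= Num.max gam 0.
  rewrite -lee_fin -(@lee_pmul2r _ (P (V @^-1` B1)))//.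
  apply: (@le_trans _ _ (\int[P]_(w in V @^-1` B1) (F (lin (V w)))%:E)%E).
    apply: integral_ge_cst; [exact: mVB|exact/ltW/F0|move=> w Bw].
    by rewrite lee_fin Fle// l1.
  rewrite -gF//; apply: integral_le_cst; [exact: mVB|by rewrite le_max lexx orbT|].
  by move=> w Bw; rewrite lee_fin le_max g1.
have gam0 : 0 < gam.
  have := lt_le_trans (F0 _) F1g; rewrite lt_max ltxx orbF//.
have F2g : gam <= F (beta k + 3 * e * M).
  rewrite -lee_fin -(@lee_pmul2r _ (P (V @^-1` B2)))//.
  apply: (@le_trans _ _ (\int[P]_(w in V @^-1` B2) (F (lin (V w)))%:E)%E).
    rewrite -gF//; apply: integral_ge_cst; [exact: mVB|exact: ltW|move=> w Bw].
    by rewrite lee_fin g2.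
  apply: integral_le_cst; [exact: mVB|exact/ltW/F0|move=> w Bw].
  by rewrite lee_fin Fle// l2.
have gam0' := ltW gam0; move: F1g; rewrite max_l// leNgt => /negP; apply.
apply: le_lt_trans F2g _; apply: Fmono; rewrite -mulrA eM; lra.
Qed.

End MonotoneVersion.

(** * Orderings that are CIS *)

Section CIS.
Variables (d : measure_display) (T : measurableType d) (R : realType).
Variables (P : probability T R) (m : nat) (X : 'I_m -> {RV P >-> R}).
Variable S : 'M[R]_m.
Hypothesis Spd : posdef S.
Hypothesis gX : centered_gaussian X S.

Lemma continuous_tail_cond_mean n (K : 'M[R]_n.+1) (t : R) :
  0 < K ord_max ord_max ->
  continuous (fun y : 'rV[R]_n =>
    normal_tail (cond_sd K) t (cond_mean K [tuple y ord0 j | j < n])).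
Proof.
move=> K0 y; apply: continuous_comp; last first.
  by apply: continuous_normal_tail; exact: cond_sd_neq0.
rewrite /cond_mean; move: y.
apply: continuous_big => [|j _]; first exact: add_continuous.
under eq_fun do rewrite tnth_mktuple.
move=> y; apply: (@continuousM _ _ (fun=> reg_coef K j)
  (fun x : 'rV[R]_n => x ord0 j)).
  exact: cst_continuous.
exact: coord_continuous.
Qed.

(** The normal tail of the conditional mean is the version used in one direction;
    in the other direction the threshold [0] already gives all coefficients. *)
Theorem CIS_sign_ordering (s : 'S_m) : CIS (permuted X s) <-> sign_ordering S s.
Proof.
split=> [Xcis i|so i t].
  apply/(cand_prefixP Spd) => k.
  have [g [[_ gid] gmono]] := Xcis i 0.
  have K0 := prefix_prec_gt0 Spd s (ltn_ord i) ord_max.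
  apply: (monotone_version_coef_ge0 (P := P)
    (V := predecessors (fun j => permuted X s j : T -> R) i)
    (F := normal_tail (cond_sd (prefix_prec S s (ltn_ord i))) 0)
    (beta := reg_coef (prefix_prec S s (ltn_ord i))) _ _ _ gmono).
  - exact: measurable_predecessors.
  - by move=> x y xy; apply: normal_tail_lt => //; exact: cond_sd_neq0.
  - by move=> x; apply: normal_tail_gt0; exact: cond_sd_neq0.
  - by move=> a b; exact: (gaussian_law_box_gt0 (law_predecessors Spd gX s i)).
  - by move=> B mB; rewrite -gid// (predecessors_tail Spd gX).
have K0 := prefix_prec_gt0 Spd s (ltn_ord i) ord_max.
exists (fun y => normal_tail (cond_sd (prefix_prec S s (ltn_ord i))) t
   (cond_mean (prefix_prec S s (ltn_ord i)) y)); split; first split.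
- exact: continuous_tail_cond_mean.
- by move=> B mB; rewrite (predecessors_tail Spd gX).
- move=> k y z yz yzk; rewrite normal_tail_le; last exact: cond_sd_neq0.
  apply: ler_sum => j _; have [->|/yz->//] := eqVneq j k.
  by apply: ler_wpM2l => //; have /(cand_prefixP Spd) := so i; exact.
Qed.

End CIS.

Theorem theorem6p2 (d : measure_display) (T : measurableType d)
    (R : realType) (P : probability T R) (m : nat)
    (X : 'I_m -> {RV P >-> R}) (Sigma : 'M[R]_m)
    (Sigma_posdef : posdef Sigma)
    (X_gaussian : centered_gaussian X Sigma)
    (CIS_ordering_exists : exists tau : 'S_m, CIS (permuted X tau)) :
  (* the procedure never gets stuck before the m-th iteration is completed *)
  (forall (ks : seq 'I_m) (O C : {set 'I_m}),
      run Sigma ks O C -> (size ks < m)%N -> exists k : 'I_m, k \in C) /\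
  (* the elements taken in m iterations, read backwards, are a CIS ordering *)
  (forall (ks : m.-tuple 'I_m) (O C : {set 'I_m}),
      run Sigma ks O C ->
      exists sigma : 'S_m,
        (forall i : 'I_m, sigma (rev_ord i) = tnth ks i) /\
        CIS (permuted X sigma)).
Proof.
have [|stuck order] := greedy_elimination Sigma_posdef.
  have [tau tauP] := CIS_ordering_exists; exists tau.
  exact/(CIS_sign_ordering Sigma_posdef X_gaussian).
split=> // ks O C /order[sigma [sE so]]; exists sigma; split=> //.
exact/(CIS_sign_ordering Sigma_posdef X_gaussian).
Qed.
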